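(* Let $k\in\mathbb N$ and fix $\eta>0$. Then there exists a missing-digit fractal $\mathcal K\subseteq[0,1]^k$ with $\mathcal K\supseteq[0,1]^{k-1}\times\{0\}$ such that \[ \#\mathcal N_{\mathcal K}(Q,0)\ll Q^{k+\eta}\quad(Q\geqslant1)\qquad\text{and}\qquad \dim_{\mathrm H}(\mathcal K)>k-\eta. \]
   Context: A missing-digit fractal is a set $\mathcal K_{b,\mathcal D}=\{\sum_{j\geqslant1}\mathbf d^{(j)}b^{-j}:\mathbf d^{(j)}\in\mathcal D\}\subseteq[0,1]^k$ with integers $b\geqslant2$ and nonempty $\mathcal D\subseteq\{0,1,\dots,b-1\}^k$. $\dim_{\mathrm H}$ is Hausdorff dimension. $\mathcal N_{\mathcal K}(Q,0)=\{(\mathbf a,q)\in\mathbb Z^k\times(\mathbb Z\cap[1,Q]):\ \mathbf a/q\in\mathcal K\}$. *)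

(* Defs.v *)
From HB Require Import structures.
From mathcomp Require Import all_boot all_order all_algebra.
From mathcomp Require Import all_classical all_reals all_analysis.
Set Implicit Arguments. Unset Strict Implicit. Unset Printing Implicit Defensive.
Import Order.TTheory GRing.Theory Num.Theory.
Import numFieldNormedType.Exports.
Local Open Scope classical_set_scope.
Local Open Scope ring_scope.

Definition edist (R : realType) (k : nat) (x y : 'I_k -> R) : R :=
  Num.sqrt (\sum_(i < k) (x i - y i) ^+ 2).

(* diameter (in \bar R; +oo for unbounded sets, -oo for the empty set) *)
Definition diam (R : realType) (k : nat) (U : set ('I_k -> R)) : \bar R :=
  ereal_sup [set (edist x y)%:E | x in U & y in U].

Definition cover_cost (R : realType) (k : nat) (s : R) (U : set ('I_k -> R)) : \bar R :=
  if pselect (U = set0) then 0%E else ((fine (diam U)) `^ s)%:E.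

Definition hausdorff_delta (R : realType) (k : nat) (s delta : R)
    (A : set ('I_k -> R)) : \bar R :=
  ereal_inf [set (\sum_(0 <= i <oo) cover_cost s (F i))%E |
     F in [set F : nat -> set ('I_k -> R) |
        A `<=` \bigcup_i F i /\ forall i, (diam (F i) <= delta%:E)%E]].

Definition hausdorff_measure (R : realType) (k : nat) (s : R)
    (A : set ('I_k -> R)) : \bar R :=
  ereal_sup [set hausdorff_delta s delta A | delta in [set d : R | 0 < d]].

Definition hausdorff_dim (R : realType) (k : nat) (A : set ('I_k -> R)) : \bar R :=
  ereal_inf [set s%:E | s in [set s : R | 0 <= s /\ hausdorff_measure s A = 0%E]].

(* K_{b,D} = { sum_{j>=1} d^(j) b^-j : d^(j) in D } ; digit vectors d^(j)
   in {0..b-1}^k are finite functions 'I_k -> 'I_b; the digit sequence is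
   indexed from 0, i.e. d j = d^(j+1). *)
Definition missing_digit_set (R : realType) (k b : nat)
    (D : {set {ffun 'I_k -> 'I_b}}) : set ('I_k -> R) :=
  [set x | exists d : nat -> {ffun 'I_k -> 'I_b},
     (forall j, d j \in D) /\
     forall i : 'I_k,
       (fun n => \sum_(0 <= j < n) ((nat_of_ord (d j i))%:R / (b%:R ^+ j.+1) : R))
         @ \oo --> x i].

Definition is_missing_digit_fractal (R : realType) (k : nat) (K : set ('I_k -> R)) :=
  exists (b : nat) (D : {set {ffun 'I_k -> 'I_b}}),
    (2 <= b)%N /\ D != finset.set0 /\ K = @missing_digit_set R k b D.

Definition face0 (R : realType) (k : nat) : set ('I_k -> R) :=
  [set x | forall i : 'I_k,
     if (nat_of_ord i == k.-1)%N then x i = 0 else 0 <= x i <= 1].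

Definition rat_points (R : realType) (k : nat) (K : set ('I_k -> R)) (Q : R)
    : set ({ffun 'I_k -> int} * int) :=
  [set p : {ffun 'I_k -> int} * int | (1 <= p.2)%R /\ (p.2%:~R <= Q) /\
           K (fun i => (p.1 i)%:~R / p.2%:~R)].

Definition count_rat_points (R : realType) (k : nat) (K : set ('I_k -> R)) (Q : R)
    : \bar R :=
  (\esum_(p in rat_points K Q) 1)%E.

(* Main.v *)
Require Import Defs.
From HB Require Import structures.
From mathcomp Require Import all_boot all_order all_algebra complex zify ring lra.
From mathcomp Require Import all_classical all_reals all_analysis.
Set Implicit Arguments. Unset Strict Implicit. Unset Printing Implicit Defensive.
Import Order.TTheory GRing.Theory Num.Theory.
Import numFieldNormedType.Exports.
Local Open Scope classical_set_scope.
Local Open Scope ring_scope.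

(** The fractal is [0,1]^(k-1) x C, where C is the set of reals whose digits in
    base b = 8HN are all less than N.  Put d = eta/2 and choose H, then N, so
    large that H^d >= 4 and N^d >= 8H.

    Counting.  If x is in C, every b^j x lies within 1/(8H) above an integer,
    so e(h b^j x) has real part at least 1/2 for all h < H.  Let S_J be the set
    of the H^J integers \sum_(j < J) h_j b^j with h_j < H.  The exponential sum
    of S_J at x factors over j, so its modulus is at least (H/2)^J.  By Parseval,
    the sum of its squared modulus over all a/q with a mod q is q times the number
    of pairs in S_J congruent mod q.  Summing over q <= n, the diagonal pairs
    contribute n^2 H^J and the others n H^(2J) times a divisor function, so C has
    at most 4^J n (n H^-J + n^o(1)) fractions of denominator at most n.  Taking
    H^J about n makes 4^J at most about n^d.

    Dimension.  Reading base-#|D| digits as elements of D maps [0,1] into K, and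
    the preimage of a set of diameter at most b^-n is covered by 5^k intervals of
    length #|D|^-n.  The image of Lebesgue measure is therefore a mass distribution
    of exponent log #|D| / log b, which is at least k - d. *)

(** * Divisors, congruent pairs and digits *)

Lemma size_divisors (n : nat) :
  size (divisors n) = (\prod_(p <- primes n) (logn p n).+1)%N.
Proof.
rewrite -(big_map (fun p => (p, logn p n)) xpredT (fun f => f.2.+1)).
rewrite -prime_decompE /divisors.
elim: (prime_decomp n) => [|f s IHs]; first by rewrite big_nil.
rewrite big_cons -IHs /=; case: f => p e /=.
elim: e => [|e IHe] /=; first by rewrite mul1n.
by rewrite size_merge size_cat size_map IHe [in RHS]mulSn addnC.
Qed.

Lemma leq_expS_exp2 (e j : nat) : (0 < e)%N -> (j.+1 ^ e <= e ^ e * 2 ^ j)%N.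
Proof.
move=> e_gt0; have leSj : (j.+1 <= e * 2 ^ (j %/ e))%N.
  apply: (leq_trans (n := (e * (j %/ e).+1)%N)); first by rewrite mulnC ltn_ceil.
  by rewrite leq_mul2l ltn_expl // orbT.
apply: (leq_trans (n := ((e * 2 ^ (j %/ e)) ^ e)%N)); first by rewrite leq_exp2r.
by rewrite expnMn leq_mul2l -expnM leq_pexp2l ?orbT // leq_divM.
Qed.

Lemma leq_expS_expn (e p j : nat) : (0 < e)%N -> (1 < p)%N ->
  (j.+1 ^ e <= (if p < 2 ^ e then e ^ e else 1) * p ^ j)%N.
Proof.
move=> e_gt0 p_gt1; case: ltnP => [_|le_p].
  apply: leq_trans (leq_expS_exp2 _ e_gt0) _.
  by case: j => [|j]; rewrite // leq_mul2l leq_exp2r ?p_gt1 ?orbT.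
rewrite mul1n; apply: (leq_trans (n := ((2 ^ j) ^ e)%N)).
  by rewrite leq_exp2r // ltn_expl.
by rewrite -expnM mulnC expnM; case: j => // j; rewrite leq_exp2r.
Qed.

Lemma exp_size_divisors_le (e n : nat) : (0 < e)%N -> (0 < n)%N ->
  (size (divisors n) ^ e <= (e ^ e) ^ (2 ^ e) * n)%N.
Proof.
move=> e_gt0 n_gt0.
pose small_factor p := (if p < 2 ^ e then e ^ e else 1)%N.
have small_prod : (\prod_(p <- primes n) small_factor p <= (e ^ e) ^ (2 ^ e))%N.
  rewrite -big_mkcond big_const_seq iter_muln_1 leq_pexp2l ?expn_gt0 ?e_gt0 //.
  rewrite -size_filter -[leqRHS](size_iota 0) uniq_leq_size //.
    by rewrite filter_uniq // primes_uniq.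
  by move=> p; rewrite mem_filter mem_iota => /andP[].
have nE : n = (\prod_(p <- primes n) p ^ logn p n)%N.
  by rewrite [LHS]prod_prime_decomp // prime_decompE big_map.
rewrite [X in (_ <= _ * X)%N]nE; apply: leq_trans (leq_mul small_prod (leqnn _)).
rewrite size_divisors -big_split /=.
rewrite (big_morph (fun x => x ^ e)%N (id1 := 1%N) (op1 := muln)).
- rewrite big_seq [leqRHS]big_seq; apply: leq_prod => p.
  by rewrite mem_primes => /and3P[p_pr _ _]; rewrite leq_expS_expn ?prime_gt1.
- by move=> x y; rewrite expnMn.
- by rewrite exp1n.
Qed.

Lemma size_divisors_le_powR (R : realType) (eps : R) : 0 < eps ->
  exists2 C : R, 0 < C &
    forall n, (0 < n)%N -> (size (divisors n))%:R <= C * n%:R `^ eps.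
Proof.
move=> eps_gt0; pose e := (Num.truncn eps^-1).+1.
pose A : nat := ((e ^ e) ^ (2 ^ e))%N.
exists (A%:R `^ e%:R^-1) => [|n n_gt0]; first by rewrite powR_gt0 // ltr0n !expn_gt0.
have e_neq0 : e%:R != 0 :> R by rewrite pnatr_eq0.
have -> : (size (divisors n))%:R = ((size (divisors n) ^ e)%:R) `^ e%:R^-1 :> R.
  by rewrite natrX -powR_mulrn // -powRrM divff // powRr1.
apply: (le_trans (y := (A * n)%:R `^ e%:R^-1)).
  by apply: ge0_ler_powR; rewrite ?nnegrE ?invr_ge0 // ler_nat exp_size_divisors_le.
rewrite natrM powRM // ler_wpM2l ?powR_ge0 // ler_powR ?ler1n //.
by rewrite ltW // invf_plt ?posrE ?ltr0n // truncnS_gt.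
Qed.

Definition congruent_pairs (I : finType) (s : I -> nat) (q : nat) : {set I * I} :=
  [set ij | s ij.1 == s ij.2 %[mod q]].

Lemma card_congruent_pairs (I : finType) (s : I -> nat) (q : nat) :
  #|congruent_pairs s q| = (\sum_i \sum_j (s i == s j %[mod q]))%N.
Proof. by rewrite -sum1dep_card big_mkcond (pair_bigA _ (fun i j => _ : nat)). Qed.

Lemma count_congruent_le (n x y : nat) : (x < y)%N ->
  (\sum_(1 <= q < n.+1) (x == y %[mod q]) <= size (divisors (y - x)))%N.
Proof.
move=> lt_xy; under eq_bigr do rewrite eq_sym eqn_mod_dvd 1?ltnW //.
rewrite -(big_mkcond (fun q => q %| y - x)%N (fun=> 1%N)) /=.
rewrite sum1_count -size_filter uniq_leq_size ?filter_uniq ?iota_uniq //.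
by move=> q; rewrite mem_filter -dvdn_divisors ?subn_gt0 // => /andP[].
Qed.

Lemma count_congruent_neq_le (n x y X D : nat) : x != y -> (x < X)%N -> (y < X)%N ->
  (forall z, 0 < z < X -> size (divisors z) <= D)%N ->
  (\sum_(1 <= q < n.+1) (x == y %[mod q]) <= D)%N.
Proof.
wlog lt_xy : x y / (x < y)%N => [wlog_lt|] neq_xy lt_xX lt_yX divD.
  have := neq_xy; rewrite neq_ltn => /orP[lt_xy|lt_yx]; first exact: wlog_lt.
  by under eq_bigr do rewrite eq_sym; apply: wlog_lt; rewrite // eq_sym.
apply: leq_trans (count_congruent_le n lt_xy) _; apply: divD.
by rewrite subn_gt0 lt_xy (leq_ltn_trans (leq_subr _ _)).
Qed.

Lemma sum_card_congruent_pairs_le (I : finType) (s : I -> nat) (n X D : nat) :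
  injective s -> (forall i, s i < X)%N ->
  (forall z, 0 < z < X -> size (divisors z) <= D)%N ->
  (\sum_(1 <= q < n.+1) #|congruent_pairs s q| <= #|I| * n + #|I| ^ 2 * D)%N.
Proof.
move=> s_inj s_lt divD.
have count_le (i j : I) :
    (\sum_(1 <= q < n.+1) (s i == s j %[mod q]) <= (i == j) * n + D)%N.
  have [<-|neq_ij] := eqVneq i j.
    rewrite mul1n (leq_trans _ (leq_addr _ _)) //.
    by under eq_bigr do rewrite eqxx; rewrite sum_nat_const_nat muln1 subn1.
  by apply: (count_congruent_neq_le n _ (s_lt i) (s_lt j) divD); rewrite (inj_eq s_inj).
under eq_bigr do rewrite card_congruent_pairs.
rewrite exchange_big /=.
apply: (leq_trans (n := (\sum_(i : I) \sum_(j : I) ((i == j) * n + D))%N)).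
  by apply: leq_sum => i _; rewrite exchange_big; apply: leq_sum => j _; exact: count_le.
rewrite (eq_bigr (fun=> (n + #|I| * D)%N)) => [|i _].
  by rewrite sum_nat_const mulnDr mulnA mulnn.
rewrite big_split /= sum_nat_const (bigD1 i) //= eqxx mul1n big1 ?addn0 // => j.
by rewrite eq_sym => /negbTE ->.
Qed.

Definition digit_number (b n : nat) (d : 'I_n -> nat) : nat :=
  (\sum_(j < n) d j * b ^ j)%N.

Lemma digit_numberS (b n : nat) (d : 'I_n.+1 -> nat) :
  digit_number b d = (d ord0 + digit_number b (fun j => d (lift ord0 j)) * b)%N.
Proof.
rewrite /digit_number big_ord_recl expn0 muln1 big_distrl /=; congr (_ + _)%N.
by apply: eq_bigr => j _; rewrite -mulnA -expnSr.
Qed.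

Lemma digit_number_lt (b n : nat) (d : 'I_n -> nat) :
  (forall j, d j < b)%N -> (digit_number b d < b ^ n)%N.
Proof.
elim: n d => [|n IHn] d lt_d; first by rewrite /digit_number big_ord0.
rewrite digit_numberS expnSr.
have := IHn _ (fun j => lt_d (lift ord0 j)); move: (digit_number b _) => u lt_u.
apply: (leq_trans (n := (u.+1 * b)%N)); last by rewrite leq_mul2r lt_u orbT.
by rewrite mulSn -addSn leq_add2r lt_d.
Qed.

Lemma digit_number_inj (b n : nat) (d d' : 'I_n -> nat) :
  (forall j, d j < b)%N -> (forall j, d' j < b)%N ->
  digit_number b d = digit_number b d' -> d =1 d'.
Proof.
elim: n d d' => [|n IHn] d d' lt_d lt_d'; first by move=> _ [].
have b_gt0 : (0 < b)%N by apply: leq_ltn_trans (lt_d ord0).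
rewrite !digit_numberS ![(_ + _ * b)%N]addnC => eq_dd' j.
have [i ->|->] := unliftP ord0 j; last first.
  by have := congr1 (modn^~ b) eq_dd'; rewrite !modnMDl !modn_small.
apply: (IHn (fun j => d (lift ord0 j)) (fun j => d' (lift ord0 j))) => //.
by have := congr1 (divn^~ b) eq_dd'; rewrite !divnMDl // !divn_small // !addn0.
Qed.

(** * Exponential sums *)

Lemma sum_expr_unity_root (F : idomainType) (q : nat) (w : F) : w ^+ q = 1 ->
  \sum_(a < q) w ^+ a = if w == 1 then q%:R else 0.
Proof.
move=> wq; case: eqVneq => [->|w_neq1].
  by under eq_bigr do rewrite expr1n; rewrite sumr_const card_ord.
apply/eqP; have /eqP := subrX1 w q.
by rewrite wq subrr eq_sym mulf_eq0 subr_eq0 (negbTE w_neq1).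
Qed.

Lemma sum_sqr_norm_exp_sum (C : numClosedFieldType) (q : nat) (z : C)
    (I : finType) (s : I -> nat) : q.-primitive_root z ->
  \sum_(a < q) `|\sum_i (z ^+ a) ^+ s i| ^+ 2 = (q * #|congruent_pairs s q|)%:R.
Proof.
move=> z_prim; have z_norm : `|z| = 1.
  apply/eqP; rewrite -(pexpr_eq1 (prim_order_gt0 z_prim)) //.
  by rewrite -normrX (prim_expr_order z_prim) normr1.
have z_neq0 : z != 0 by rewrite -normr_eq0 z_norm oner_eq0.
have z_conj : z^* = z^-1 by rewrite invC_norm z_norm expr1n invr1 mul1r.
have sqr_normE (a : 'I_q) : `|\sum_i (z ^+ a) ^+ s i| ^+ 2 =
    \sum_i \sum_j (z ^+ s i / z ^+ s j) ^+ a.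
  rewrite normCK rmorph_sum big_distrl; apply: eq_bigr => i _.
  rewrite big_distrr; apply: eq_bigr => j _ /=.
  by rewrite !rmorphXn /= z_conj exprMn !exprVn -!exprM ![(a * _)%N]mulnC.
under eq_bigr do rewrite sqr_normE.
rewrite exchange_big card_congruent_pairs natrM natr_sum mulr_sumr.
apply: eq_bigr => i _; rewrite exchange_big natr_sum mulr_sumr; apply: eq_bigr => j _ /=.
rewrite sum_expr_unity_root; last first.
  by rewrite exprMn exprVn -!exprM ![(_ * q)%N]mulnC !exprM (prim_expr_order z_prim)
    !expr1n divr1.
rewrite -(eq_prim_root_expr z_prim) -(inj_eq (mulIf (expf_neq0 (s j) z_neq0))).
by rewrite mul1r divfK ?expf_neq0 //; case: eqP; rewrite ?mulr1 ?mulr0.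
Qed.

Section CircleExponential.
Variable R : realType.
Implicit Types x y : R.
Local Open Scope complex_scope.

Definition expi2pi x : R[i] := cos (pi *+ 2 * x) +i* sin (pi *+ 2 * x).

Lemma expi2piD x y : expi2pi (x + y) = expi2pi x * expi2pi y.
Proof. by rewrite /expi2pi mulrDr cosD sinD; simpc; rewrite [X in _ +i* X]addrC. Qed.

Lemma expi2pi0 : expi2pi 0 = 1.
Proof. by rewrite /expi2pi mulr0 cos0 sin0. Qed.

Lemma expi2pi_sum (I : Type) (r : seq I) (F : I -> R) :
  expi2pi (\sum_(i <- r) F i) = \prod_(i <- r) expi2pi (F i).
Proof. exact: (big_morph expi2pi expi2piD expi2pi0). Qed.

Lemma expi2pi_natM (n : nat) x : expi2pi (n%:R * x) = expi2pi x ^+ n.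
Proof.
elim: n => [|n IHn]; first by rewrite mul0r expi2pi0.
by rewrite -natr1 mulrDl mul1r expi2piD IHn exprSr.
Qed.

Lemma expi2pi_nat (n : nat) : expi2pi n%:R = 1.
Proof.
by rewrite -[n%:R]mulr1 expi2pi_natM /expi2pi mulr1 cos2pi sin2pi expr1n.
Qed.

Lemma expi2pi_int (z : int) : expi2pi z%:~R = 1.
Proof.
case: z => n; first exact: expi2pi_nat.
rewrite -[LHS]mul1r -[1 in LHS](expi2pi_nat n.+1) -expi2piD NegzE mulrNz subrr.
exact: expi2pi0.
Qed.

Lemma Re_expi2pi_ge_half x : 0 <= x <= 8^-1 -> 2^-1 <= complex.Re (expi2pi x).
Proof.
move=> /andP[x_ge0 x_le]; rewrite /=; set y := pi *+ 2 * x.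
have pi_pos : 0 < pi :> R := pi_gt0 R.
have y_ge0 : 0 <= y by rewrite mulr_ge0 // mulrn_wge0 // ltW.
have y_le : y <= pi / 4.
  have -> : pi / 4 = pi *+ 2 * 8^-1 :> R by field.
  by rewrite ler_pM2l // pmulrn_lgt0.
have cos_y : 0 <= cos y by apply: cos_ge0_pihalf; apply/andP; split; lra.
have : 0 <= cos (y *+ 2).
  by apply: cos_ge0_pihalf; rewrite -mulr_natr; apply/andP; split; lra.
by rewrite cos_mulr2n -mulr_natr; have := cos_le1 y; nra.
Qed.

Lemma expi2pi_neq1 x : 0 < x < 1 -> expi2pi x != 1.
Proof.
move=> /andP[x_gt0 x_lt1]; apply/eqP => -[+ _].
have -> : pi *+ 2 * x = (pi * x) *+ 2 by rewrite mulrnAl.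
have sin_gt0 : 0 < sin (pi * x).
  by apply: sin_gt0_pi; rewrite mulr_gt0 ?pi_gt0 //= gtr_pMr ?pi_gt0.
by rewrite cos_mulr2n cos2sin2 -mulr_natr; nra.
Qed.

Lemma expi2piV_prim_root (q : nat) : (0 < q)%N ->
  q.-primitive_root (expi2pi q%:R^-1).
Proof.
move=> q_gt0; have qR_gt0 : 0 < q%:R :> R by rewrite ltr0n.
have [|m m_prim m_dvd] := @prim_order_exists _ q (expi2pi q%:R^-1) q_gt0.
  by rewrite -expi2pi_natM divff ?gt_eqF // (expi2pi_nat 1).
have m_gt0 := prim_order_gt0 m_prim.
suff mE : m = q by rewrite mE in m_prim.
apply/eqP; rewrite eqn_leq dvdn_leq //= leqNgt; apply/negP => m_lt.
have /eqP := prim_expr_order m_prim; rewrite -expi2pi_natM; apply/negP.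
by rewrite expi2pi_neq1 // divr_gt0 ?ltr0n //= ltr_pdivrMr // mul1r ltr_nat.
Qed.

End CircleExponential.

Definition narrow_orbit (R : realType) (b H : nat) (x : R) :=
  forall j, exists z : int, z%:~R <= b%:R ^+ j * x <= z%:~R + (8 * H%:R)^-1.

Section NarrowOrbits.
Variables (R : realType) (b H : nat).
Implicit Type x : R.

Local Notation frequency f := (digit_number b (fun j => nat_of_ord (f j))).

Lemma norm_sum_expi2pi_ge x (z : int) : z%:~R <= x <= z%:~R + (8 * H%:R)^-1 ->
  H%:R / 2 <= `|\sum_(h < H) expi2pi (h%:R * x)|.
Proof.
move=> /andP[z_le le_z]; pose t : R := x - z%:~R.
have Re_ge (h : 'I_H) : 2^-1 <= complex.Re (expi2pi (h%:R * x)).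
  have -> : h%:R * x = h%:R * t + (h%:Z * z)%:~R by rewrite intrM /t; ring.
  rewrite expi2piD expi2pi_int mulr1; apply: Re_expi2pi_ge_half.
  have t_ge0 : 0 <= t by rewrite subr_ge0.
  have HR_gt0 : 0 < H%:R :> R by rewrite ltr0n (leq_ltn_trans _ (ltn_ord h)).
  rewrite mulr_ge0 //=.
  have -> : 8^-1 = H%:R * (8 * H%:R)^-1 :> R by field; rewrite gt_eqF.
  by apply: ler_pM => //; [rewrite ler_nat ltnW|rewrite lerBlDl].
apply: le_trans (normc_ge_Re _).
have -> : H%:R / 2 = (H%:R / 2)%:C%C :> R[i] by rewrite rmorphM fmorphV !rmorph_nat.
rewrite lecR (le_trans _ (ler_norm _)) // raddf_sum.
have -> : H%:R / 2 = \sum_(h < H) 2^-1 :> R by rewrite sumr_const card_ord mulr_natl.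
by apply: ler_sum => h _; exact: Re_ge.
Qed.

Lemma norm_digit_sum_expi2pi_ge (J : nat) x : narrow_orbit b H x ->
  (H%:R / 2) ^+ J <=
    `|\sum_(f : {ffun 'I_J -> 'I_H}) expi2pi ((frequency f)%:R * x)|.
Proof.
move=> x_narrow.
have -> : \sum_(f : {ffun 'I_J -> 'I_H}) expi2pi ((frequency f)%:R * x) =
    \prod_(j < J) \sum_(h < H) expi2pi (h%:R * (b%:R ^+ j * x)).
  rewrite bigA_distr_bigA; apply: eq_bigr => f _.
  rewrite /digit_number natr_sum mulr_suml expi2pi_sum; apply: eq_bigr => j _.
  by rewrite natrM natrX mulrA.
rewrite normr_prod -[J in _ ^+ J]card_ord -prodr_const; apply: ler_prod => j _.
by have [z /norm_sum_expi2pi_ge ->] := x_narrow j; rewrite divr_ge0.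
Qed.

Definition narrow_numerators (q : nat) : {set 'I_q} :=
  [set a : 'I_q | `[< narrow_orbit b H (a%:R / q%:R : R) >]].

Lemma card_narrow_numerators_le (J q : nat) : (0 < q)%N ->
  (H ^ (2 * J) * #|narrow_numerators q| <= 4 ^ J * (q *
    #|congruent_pairs (fun f : {ffun 'I_J -> 'I_H} => frequency f) q|))%N.
Proof.
move=> q_gt0; rewrite -(ler_nat R[i]) natrM [leRHS]natrM.
rewrite -(sum_sqr_norm_exp_sum _ (expi2piV_prim_root R q_gt0)).
have -> : (H ^ (2 * J))%:R = (4 ^ J)%:R * (H%:R / 2) ^+ J ^+ 2 :> R[i].
  rewrite !natrX exprM -[_ ^+ J ^+ 2]exprM mulnC exprM -exprMn; congr (_ ^+ _).
  by field.
rewrite -mulrA ler_wpM2l // -sum1_card natr_sum mulr_sumr big_mkcond /=.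
apply: ler_sum => a _; rewrite inE; case: asboolP => [a_narrow|_]; last exact: exprn_ge0.
rewrite mulr1 lerXn2r ?nnegrE ?exprn_ge0 ?divr_ge0 //.
under eq_bigr do rewrite -!expi2pi_natM.
exact: norm_digit_sum_expi2pi_ge.
Qed.

Lemma sum_card_narrow_numerators_le (J n D : nat) : (H <= b)%N -> (n < H ^ J)%N ->
  (forall z, 0 < z < b ^ J -> size (divisors z) <= D)%N ->
  (\sum_(1 <= q < n.+1) #|narrow_numerators q| <= 4 ^ J * n * D.+1)%N.
Proof.
move=> leHb lt_n divD; have HJ_gt0 : (0 < H ^ J)%N by apply: leq_ltn_trans lt_n.
rewrite -(leq_pmul2l (m := H ^ (2 * J))); last by rewrite mulnC expnM expn_gt0 HJ_gt0.
pose s (f : {ffun 'I_J -> 'I_H}) := frequency f.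
have f_lt (f : {ffun 'I_J -> 'I_H}) j : (f j < b)%N by rewrite (leq_trans (ltn_ord _)).
have s_inj : injective s.
  move=> f g eq_fg; apply/ffunP => j; apply: val_inj.
  exact: (digit_number_inj (f_lt f) (f_lt g) eq_fg).
have s_lt f : (s f < b ^ J)%N := digit_number_lt (f_lt f).
have sum_pairs := sum_card_congruent_pairs_le n s_inj s_lt divD.
apply: (leq_trans (n := (4 ^ J * (n * \sum_(1 <= q < n.+1) #|congruent_pairs s q|))%N)).
  rewrite !big_distrr big_nat [leqRHS]big_nat; apply: leq_sum => q /andP[q_gt0 q_lt] /=.
  apply: leq_trans (card_narrow_numerators_le J q_gt0) _.
  by rewrite leq_mul2l leq_mul2r -ltnS q_lt !orbT.
rewrite mulnA mulnCA leq_mul2l; apply/orP; right; apply: leq_trans sum_pairs _.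
rewrite card_ffun !card_ord -expnM [(J * 2)%N]mulnC mulnS leq_add2r.
by rewrite mul2n -addnn expnD leq_mul2l (ltnW lt_n) orbT.
Qed.

End NarrowOrbits.

Lemma size_divisors_lt_expn (R : realType) (b H : nat) (d : R) :
  (0 < b)%N -> (1 < H)%N -> 0 < d ->
  exists2 C : R, 0 < C & forall J z, (0 < z < b ^ J)%N ->
    (size (divisors z))%:R <= C * (H ^ J)%:R `^ d.
Proof.
move=> b_gt0 H_gt1 d_gt0; have bR_gt0 : 0 < b%:R :> R by rewrite ltr0n.
have [C C_gt0 divC] := size_divisors_le_powR (divr_gt0 d_gt0 bR_gt0).
exists C => // J z /andP[z_gt0 z_lt]; apply: le_trans (divC z z_gt0) _.
rewrite ler_pM2l //.
have -> : (H ^ J)%:R `^ d = ((H ^ J) ^ b)%:R `^ (d / b%:R) :> R.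
  by rewrite [in RHS]natrX -powR_mulrn // -powRrM [b%:R * _]mulrC divfK // gt_eqF.
have J_gt0 : (0 < J)%N by case: J z_lt => //; rewrite ltnS leqNgt z_gt0.
rewrite ge0_ler_powR ?nnegrE ?divr_ge0 ?(ltW d_gt0) // ler_nat ltnW //.
by rewrite (leq_trans z_lt) // -expnM mulnC expnM leq_exp2r // ltnW // ltn_expl.
Qed.

Lemma sum_card_narrow_numerators_le_powR (R : realType) (b H : nat) (d : R) :
  (1 < H <= b)%N -> 0 < d -> 4 <= H%:R `^ d ->
  exists2 C : R, 0 < C & forall n, (0 < n)%N ->
    (\sum_(1 <= q < n.+1) #|narrow_numerators R b H q|)%:R <= C * n%:R `^ (1 + 2 * d).
Proof.
move=> /andP[H_gt1 leHb] d_gt0 le_Hd; have H_gt0 := ltnW H_gt1.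
have [C C_gt0 divC] := size_divisors_lt_expn (leq_trans H_gt0 leHb) H_gt1 d_gt0.
exists ((C + 1) * H%:R `^ (2 * d)) => [|n n_gt0].
  by rewrite mulr_gt0 ?powR_gt0 ?ltr0n ?addr_gt0.
pose J := (trunc_log H n).+1; pose X : R := (H ^ J)%:R `^ d.
have [HJ_le n_lt] : (H ^ J <= H * n)%N /\ (n < H ^ J)%N.
  have /andP[lo hi] := trunc_log_bounds H_gt1 n_gt0.
  by split; rewrite // expnS leq_mul2l lo orbT.
have X_ge1 : 1 <= X.
  rewrite -[leLHS](congr1 (@^~ d) (powR1 R)) ge0_ler_powR ?nnegrE ?(ltW d_gt0) //.
  by rewrite ler1n expn_gt0 H_gt0.
have divX z : (0 < z < b ^ J)%N -> (size (divisors z) <= Num.truncn (C * X))%N.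
  by move/divC; rewrite truncn_ge_nat // mulr_ge0 ?powR_ge0 // ltW.
have := sum_card_narrow_numerators_le R leHb n_lt divX.
rewrite -(ler_nat R) => /le_trans; apply; rewrite !natrM.
have le_X : (4 ^ J)%:R <= X.
  rewrite natrX /X natrX -powR_mulrn ?powR_ge0 // -powRrM mulrC powRrM powR_mulrn //.
  by rewrite lerXn2r ?nnegrE ?powR_ge0.
have le_CX : (Num.truncn (C * X)).+1%:R <= (C + 1) * X.
  by rewrite -natr1 mulrDl mul1r lerD // truncn_le mulr_ge0 ?powR_ge0 // ltW.
apply: (le_trans (y := X * n%:R * ((C + 1) * X))).
  by rewrite ler_pM // ler_wpM2r.
have XX_le : X * X <= H%:R `^ (2 * d) * n%:R `^ (2 * d).
  rewrite -powRM // -natrM mulr2n mulrDl mul1r.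
  rewrite powRD; last by rewrite pnatr_eq0 -lt0n muln_gt0 H_gt0 n_gt0 implybT.
  by rewrite ler_pM ?powR_ge0 // ge0_ler_powR ?nnegrE ?ler_nat // ltW.
rewrite powRD; last by rewrite pnatr_eq0 -lt0n n_gt0 implybT.
rewrite powRr1 // [leLHS](_ : _ = (C + 1) * n%:R * (X * X)); last by ring.
rewrite [leRHS](mulrACA _ _ n%:R).
by rewrite ler_wpM2l // mulr_ge0 // addr_ge0 // ltW.
Qed.

(** * Digit expansions of real numbers *)

Lemma cvgn_invX (R : realType) (b : nat) : (1 < b)%N ->
  (fun n => b%:R ^- n : R) @ \oo --> (0 : R).
Proof.
move=> b_gt1; under eq_fun do rewrite -exprVn.
by apply: cvg_expr; rewrite ger0_norm ?invr_ge0 // invf_lt1 ?ltr1n // ltr0n ltnW.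
Qed.

Definition digit_series (R : realType) (b : nat) (d : nat -> nat) : R^nat :=
  fun n => \sum_(0 <= j < n) (d j)%:R / b%:R ^+ j.+1.

Definition digit_real (R : realType) (b : nat) (d : nat -> nat) : R :=
  limn (digit_series R b d).

Fixpoint digit_prefix (b : nat) (d : nat -> nat) (n : nat) : nat :=
  if n is n'.+1 then (digit_prefix b d n' * b + d n')%N else 0%N.

Lemma digit_prefixE (b : nat) (d : nat -> nat) (n : nat) :
  digit_prefix b d n = digit_number b (fun j : 'I_n => d (n - j.+1)%N).
Proof.
elim: n => [|n IHn] /=; first by rewrite /digit_number big_ord0.
by rewrite digit_numberS subn1 addnC IHn; congr (_ + _ * _)%N.
Qed.

Lemma digit_prefix_inj (b : nat) (d d' : nat -> nat) (n : nat) :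
  (forall j, d j < b)%N -> (forall j, d' j < b)%N ->
  digit_prefix b d n = digit_prefix b d' n -> forall j, (j < n)%N -> d j = d' j.
Proof.
move=> lt_d lt_d'; rewrite !digit_prefixE => /digit_number_inj eq_dd' j lt_jn.
have := eq_dd' (fun=> lt_d _) (fun=> lt_d' _) (rev_ord (Ordinal lt_jn)).
by rewrite /= !subnS; congr (d _ = d' _); lia.
Qed.

Lemma eq_digit_prefix (b : nat) (d d' : nat -> nat) (n : nat) :
  (forall j, (j < n)%N -> d j = d' j) -> digit_prefix b d n = digit_prefix b d' n.
Proof.
elim: n => //= n IHn eq_dd'; rewrite IHn ?eq_dd' // => j lt_jn.
by rewrite eq_dd' // ltnW.
Qed.

Section DigitReal.
Variables (R : realType) (b : nat).
Hypothesis b_gt1 : (1 < b)%N.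
Implicit Types (d : nat -> nat) (y : R).

Local Notation digit_series := (digit_series R b).
Local Notation digit_real := (digit_real R b).

Let b_gt0 : 0 < b%:R :> R. Proof. by rewrite ltr0n ltnW. Qed.
Let bB1_gt0 : 0 < b%:R - 1 :> R. Proof. by rewrite subr_gt0 ltr1n. Qed.

Lemma digit_seriesS d n :
  digit_series d n.+1 = ((d 0%N)%:R + digit_series (fun j => d j.+1) n) / b%:R.
Proof.
rewrite /digit_series big_nat_recl // expr1 mulrDl mulr_suml; congr (_ + _).
by apply: eq_bigr => j _; rewrite [in LHS]exprSr invfM mulrA.
Qed.

Lemma digit_series_le (B : nat) d n :
  (forall j, d j <= B)%N -> digit_series d n <= B%:R / (b%:R - 1).
Proof.
elim: n d => [|n IHn] d le_dB.
  by rewrite /digit_series big_geq // divr_ge0 // ltW.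
rewrite digit_seriesS ler_pdivrMr //.
apply: (le_trans (y := B%:R + B%:R / (b%:R - 1))).
  by rewrite lerD ?ler_nat // IHn.
by rewrite le_eqVlt; apply/orP; left; apply/eqP; field; rewrite gt_eqF.
Qed.

Lemma cvg_digit_series d : (forall j, d j < b)%N -> digit_series d @ \oo --> digit_real d.
Proof.
move=> lt_db; apply: nondecreasing_is_cvgn.
  apply/nondecreasing_seqP => n; rewrite /digit_series big_nat_recr //= lerDl.
  by rewrite divr_ge0 // exprn_ge0 // ltW.
exists (b.-1%:R / (b%:R - 1)) => _ [n _ <-]; apply: digit_series_le => j.
by rewrite -ltnS prednK // ltnW.
Qed.

Lemma digit_real_ge0 d : (forall j, d j < b)%N -> 0 <= digit_real d.
Proof.
move=> lt_db; apply: limr_ge.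
  by apply/cvg_ex; exists (digit_real d); exact: cvg_digit_series.
by apply: nearW => n; apply: sumr_ge0 => j _; rewrite divr_ge0 // exprn_ge0 // ltW.
Qed.

Lemma digit_real_le (B : nat) d : (B < b)%N -> (forall j, d j <= B)%N ->
  digit_real d <= B%:R / (b%:R - 1).
Proof.
move=> lt_Bb le_dB; apply: limr_le; last by apply: nearW => n; exact: digit_series_le.
apply/cvg_ex; exists (digit_real d).
by apply: cvg_digit_series => j; apply: leq_ltn_trans lt_Bb.
Qed.

Lemma digit_realS d : (forall j, d j < b)%N ->
  b%:R * digit_real d = (d 0%N)%:R + digit_real (fun j => d j.+1).
Proof.
move=> lt_db; have := cvg_digit_series lt_db; rewrite -cvg_shiftS /=.
under eq_fun do rewrite digit_seriesS.
have : ((d 0%N)%:R + digit_series (fun j => d j.+1) n) / b%:R @[n --> \oo] -->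
    ((d 0%N)%:R + digit_real (fun j => d j.+1)) / b%:R.
  apply: cvgMr_tmp; apply: cvgD; first exact: cvg_cst.
  by apply: cvg_digit_series => j; exact: lt_db.
by move=> /cvg_unique tail_cvg /tail_cvg <- //; rewrite mulrC divfK // gt_eqF.
Qed.

Lemma expM_digit_real d n : (forall j, d j < b)%N ->
  b%:R ^+ n * digit_real d =
  (digit_prefix b d n)%:R + digit_real (fun j => d (n + j)%N).
Proof.
move=> lt_db; elim: n => [|n IHn]; first by rewrite mul1r add0r.
rewrite exprS -mulrA IHn mulrDr digit_realS // addn0 natrD natrM [b%:R * _]mulrC addrA.
by congr (_ + digit_real _); apply/funext => j; rewrite addnS.
Qed.

Lemma digit_prefix_bounds (B : nat) d n : (B < b)%N -> (forall j, d j <= B)%N ->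
  (digit_prefix b d n)%:R <= b%:R ^+ n * digit_real d <=
  (digit_prefix b d n)%:R + B%:R / (b%:R - 1).
Proof.
move=> lt_Bb le_dB; have lt_db j : (d j < b)%N by apply: leq_ltn_trans lt_Bb.
by rewrite expM_digit_real // lerDl lerD2l digit_real_ge0 // digit_real_le.
Qed.

Lemma digit_prefix_bounds1 d n : (forall j, d j < b)%N ->
  (digit_prefix b d n)%:R <= b%:R ^+ n * digit_real d <= (digit_prefix b d n)%:R + 1.
Proof.
move=> lt_db; have ratio1 : b.-1%:R / (b%:R - 1) = 1 :> R.
  by rewrite -subn1 natrB ?(ltnW b_gt1) // divff // gt_eqF.
rewrite -[X in _ <= _ + X]ratio1; apply: digit_prefix_bounds => [|j].
  by rewrite prednK // ltnW.
by rewrite -ltnS prednK // ltnW.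
Qed.

(* Capping the leading digit at [b - 1] also expands [y = 1]. *)
Definition leading_digit y : nat := minn b.-1 (Num.truncn (b%:R * y)).
Definition digit_tail y : R := b%:R * y - (leading_digit y)%:R.
Definition greedy_digit y (j : nat) : nat := leading_digit (iter j digit_tail y).

Lemma greedy_digit_lt y j : (greedy_digit y j < b)%N.
Proof. by rewrite -[ltnRHS](prednK (ltnW b_gt1)) ltnS geq_minl. Qed.

Lemma digit_tail_itv y : 0 <= y <= 1 -> 0 <= digit_tail y <= 1.
Proof.
move=> /andP[y_ge0 y_le1]; have by_ge0 : 0 <= b%:R * y by rewrite mulr_ge0 // ltW.
rewrite /digit_tail /leading_digit subr_ge0 lerBlDl natr1.
have /andP[lo hi] := truncn_itv by_ge0.
rewrite (le_trans _ lo) ?ler_nat ?geq_minr //= /minn; case: ifP => _; last exact: ltW.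
by rewrite prednK ?(ltnW b_gt1) // ler_piMr // ltW.
Qed.

Lemma digit_real_greedy y : 0 <= y <= 1 -> digit_real (greedy_digit y) = y.
Proof.
move=> y01; apply: cvg_lim => //.
have tail_itv n : 0 <= iter n digit_tail y <= 1.
  by elim: n => //= n; exact: digit_tail_itv.
have seriesE n : digit_series (greedy_digit y) n = y - iter n digit_tail y / b%:R ^+ n.
  elim: n => [|n IHn]; first by rewrite /digit_series big_geq // divr1 subrr.
  rewrite /digit_series big_nat_recr // -/(digit_series _ _) IHn /= {2}/digit_tail exprS.
  by rewrite -/(greedy_digit y n); field; rewrite expf_neq0 gt_eqF.
rewrite (funext seriesE).
rewrite -[X in _ --> X]subr0; apply: cvgB; first exact: cvg_cst.
apply: (@squeeze_cvgr _ _ _ _ (fun=> 0) (fun n => b%:R ^- n));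
  [|exact: cvg_cst|exact: cvgn_invX].
apply: nearW => n; have /andP[lo hi] := tail_itv n.
by rewrite divr_ge0 ?exprn_ge0 ?(ltW b_gt0) //= ler_piMl // invr_ge0 exprn_ge0 // ltW.
Qed.

End DigitReal.

Lemma missing_digit_setP (R : realType) (k b : nat) (D : {set {ffun 'I_k -> 'I_b}})
    (x : 'I_k -> R) : (1 < b)%N ->
  missing_digit_set D x <-> exists2 d : nat -> {ffun 'I_k -> 'I_b},
    forall j, d j \in D & forall i, x i = digit_real R b (fun j => d j i).
Proof.
move=> b_gt1; split=> [[d [dD x_cvg]]|[d dD xE]]; exists d => //.
  by move=> i; apply/esym/cvg_lim => //; exact: x_cvg.
by split=> // i; rewrite xE; apply: cvg_digit_series => // j; exact: ltn_ord.
Qed.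

(** * The mass distribution principle *)

Section EuclideanDiameter.
Variables (R : realType) (k : nat).
Implicit Types (x y : 'I_k -> R) (U : set ('I_k -> R)).

Lemma ler_dist_edist x y i : `|x i - y i| <= Defs.edist x y.
Proof.
rewrite -sqrtr_sqr /Defs.edist ler_sqrt ?sumr_ge0 // => [|j _]; last exact: sqr_ge0.
by rewrite (bigD1 i) //= lerDl sumr_ge0 // => j _; exact: sqr_ge0.
Qed.

Lemma edist_le_diam U x y : U x -> U y -> ((Defs.edist x y)%:E <= diam U)%E.
Proof. by move=> Ux Uy; apply: ereal_sup_ubound; exists x => //; exists y. Qed.

Lemma diam_ge0 U : U !=set0 -> (0 <= diam U)%E.
Proof.
by move=> [x Ux]; apply: le_trans (edist_le_diam Ux Ux); rewrite lee_fin sqrtr_ge0.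
Qed.

Lemma cover_cost_ge0 s U : (0 <= cover_cost s U)%E.
Proof. by rewrite /cover_cost; case: pselect => ? /=; rewrite lee_fin ?powR_ge0. Qed.

Lemma hausdorff_dim_ge0 (K : set ('I_k -> R)) : (0 <= hausdorff_dim K)%E.
Proof. by apply: le_ereal_inf_tmp => _ [s [s_ge0 _] <-]; rewrite lee_fin. Qed.

End EuclideanDiameter.

Section MassDistribution.
Variables (R : realType) (k : nat) (K : set ('I_k -> R)).
Variables (mu : {outer_measure set ('I_k -> R) -> \bar R}) (s A : R).
Hypotheses (s_gt0 : 0 < s) (A_gt0 : 0 < A).
Hypothesis mu_le : forall U (r : R), 0 < r <= 1 -> (diam U <= r%:E)%E ->
  (mu U <= (A * r `^ s)%:E)%E.

Lemma mass_le_cover_cost (t : R) (U : set ('I_k -> R)) : 0 <= t <= s ->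
  (diam U <= 1%:E)%E -> (mu U <= A%:E * cover_cost t U)%E.
Proof.
move=> /andP[t_ge0 le_ts] U_le1; have [U0|UN0] := pselect (U = set0).
  by rewrite U0 outer_measure0 mule_ge0 ?cover_cost_ge0 // lee_fin ltW.
have /set0P/diam_ge0 U_ge0 : U != set0 by apply/eqP.
have [r rE] : exists r, diam U = r%:E.
  by exists (fine (diam U)); rewrite fineK // ge0_fin_numE // (le_lt_trans U_le1) ?ltry.
move: (U_ge0) (U_le1); rewrite rE !lee_fin le_eqVlt.
move=> /predU1P[r0|r_gt0] r_le1; last first.
  have -> : cover_cost t U = (r `^ t)%:E by rewrite /cover_cost rE; case: pselect.
  apply: le_trans (mu_le (r := r) _ _) _; rewrite ?rE ?r_gt0 //.
  by rewrite -EFinM lee_fin ler_pM2l // ger_powR ?r_gt0.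
(* Letting the radius tend to [0] in [mu_le] gives [mu U = 0]. *)
apply: (le_trans (y := 0%E)); last by rewrite mule_ge0 ?cover_cost_ge0 // lee_fin ltW.
apply/lee_addgt0Pr => e e_gt0; rewrite add0e.
pose q := Num.min 1 ((e / A) `^ s^-1); have q_gt0 : 0 < q.
  by rewrite lt_min ltr01 powR_gt0 // divr_gt0.
apply: le_trans (mu_le (r := q) _ _) _; rewrite ?q_gt0 ?ge_min ?lexx //.
  by rewrite rE -r0 lee_fin; exact: ltW.
rewrite lee_fin -ler_pdivlMl // mulrC.
apply: (le_trans (y := ((e / A) `^ s^-1) `^ s)).
  by rewrite ge0_ler_powR ?nnegrE ?powR_ge0 ?(ltW s_gt0) ?(ltW q_gt0) // ge_min lexx orbT.
by rewrite -powRrM mulVf ?gt_eqF // powRr1 // divr_ge0 ?ltW.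
Qed.

Lemma mass_le_hausdorff_delta (t : R) : 0 <= t <= s ->
  (mu K <= A%:E * hausdorff_delta t 1 K)%E.
Proof.
move=> t_s; rewrite -lee_pdivrMl //; apply: le_ereal_inf_tmp => _ [F [KF F_le1] <-].
rewrite lee_pdivrMl // -nneseriesZl => [|i _]; last exact: cover_cost_ge0.
apply: le_trans (le_outer_measure mu _ _ KF) _.
apply: le_trans (outer_measure_sigma_subadditive mu F) _.
by apply: lee_nneseries => i *; [exact: outer_measure_ge0 | exact: mass_le_cover_cost].
Qed.

Lemma mass_distribution_principle : (0 < mu K)%E -> (s%:E <= hausdorff_dim K)%E.
Proof.
move=> K_gt0; apply: le_ereal_inf_tmp => _ [t [t_ge0 t_null] <-].
rewrite lee_fin leNgt; apply/negP => lt_ts.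
have t_s : 0 <= t <= s by rewrite t_ge0 ltW.
have := mass_le_hausdorff_delta t_s; rewrite leNgt => /negP; apply.
have : (hausdorff_delta t 1 K <= 0)%E.
  by rewrite -t_null; apply: ereal_sup_ubound; exists 1 => //=.
by move=> delta_le0; apply: le_lt_trans K_gt0; rewrite mule_ge0_le0 // lee_fin ltW.
Qed.

End MassDistribution.

Section RestrictedPushforward.
Variables (R : realType) (T T' : Type) (mu : {outer_measure set T -> \bar R}).
Variables (E : set T) (f : T -> T').

Definition restricted_pushforward (U : set T') : \bar R := mu (E `&` f @^-1` U).

Let pushforward0 : restricted_pushforward set0 = 0%E.
Proof. by rewrite /restricted_pushforward preimage_set0 setI0 outer_measure0. Qed.

Let pushforward_ge0 U : (0 <= restricted_pushforward U)%E.
Proof. exact: outer_measure_ge0. Qed.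

Let le_pushforward : {homo restricted_pushforward : U V / U `<=` V >-> (U <= V)%E}.
Proof. by move=> U V UV; apply: le_outer_measure; apply: setIS => x /UV. Qed.

Let pushforward_sigma_subadditive : sigma_subadditive restricted_pushforward.
Proof.
move=> F; rewrite /restricted_pushforward preimage_bigcup setI_bigcupr.
exact: outer_measure_sigma_subadditive.
Qed.

HB.instance Definition _ := isOuterMeasure.Build R T' restricted_pushforward
  pushforward0 pushforward_ge0 le_pushforward pushforward_sigma_subadditive.

End RestrictedPushforward.

Lemma outer_measure_bigcup_fin (R : realType) (T : Type) (I : finType)
    (mu : {outer_measure set T -> \bar R}) (F : I -> set T) :
  (mu (\bigcup_i F i) <= \sum_i mu (F i))%E.
Proof.
have -> : \bigcup_i F i = \big[setU/set0]_i F i.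
  by rewrite -bigcup_seq; apply: eq_bigcupl; split=> i _ //=; rewrite mem_index_enum.
elim/big_ind2: _ => [|c U c' V le_c le_c'|i _]; rewrite ?outer_measure0 //.
exact: le_trans (outer_measureU2 mu _ _) (leeD le_c le_c').
Qed.

(** * Hausdorff dimension of missing-digit sets *)

Definition outer_lebesgue (R : realType) : {outer_measure set R -> \bar R} :=
  [the {outer_measure set _ -> \bar R} of ((@lebesgue_measure R)^*)%mu].

Lemma outer_lebesgue_itvcc (R : realType) (a c : R) : a < c ->
  outer_lebesgue R `[a, c]%classic = (c - a)%:E.
Proof.
move=> lt_ac; transitivity (lebesgue_measure `[a, c]%classic).
  by apply: measurable_mu_extE; exact: measurable_itv.
by rewrite lebesgue_measure_itv /= lte_fin lt_ac -EFinB.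
Qed.

Lemma exists_invX_bracket (R : realType) (b : nat) (r : R) : (1 < b)%N -> 0 < r <= 1 ->
  exists n, b%:R ^- n.+1 < r <= b%:R ^- n.
Proof.
move=> b_gt1 /andP[r_gt0 r_le1]; pose m := Num.truncn r^-1.
have rV_ge0 : 0 <= r^-1 by rewrite invr_ge0 ltW.
have m_gt0 : (0 < m)%N by rewrite truncn_gt0 invf_ge1.
have bX_gt0 n : 0 < b%:R ^+ n :> R by rewrite exprn_gt0 // ltr0n ltnW.
have /andP[lo hi] := trunc_log_bounds b_gt1 m_gt0.
exists (trunc_log b m); rewrite invf_plt ?posrE //.
rewrite -[leLHS]invrK lef_pV2 ?posrE ?invr_gt0 //.
by rewrite -!natrX -truncn_lt_nat // hi -truncn_ge_nat.
Qed.

Lemma invX_le_powR (R : realType) (b M r s : R) (n : nat) :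
  0 < b -> 0 <= s -> b `^ s <= M -> b ^- n.+1 <= r -> M ^- n <= b `^ s * r `^ s.
Proof.
move=> b_gt0 s_ge0 le_bM le_r; have bs_gt0 : 0 < b `^ s by rewrite powR_gt0.
have r_ge0 : 0 <= r by apply: le_trans le_r; rewrite invr_ge0 exprn_ge0 // ltW.
apply: (le_trans (y := (b `^ s) ^- n)).
  have M_gt0 := lt_le_trans bs_gt0 le_bM.
  by rewrite lef_pV2 ?posrE ?exprn_gt0 // lerXn2r ?nnegrE // ltW.
have -> : (b `^ s) ^- n = b `^ s * (b ^- n.+1) `^ s.
  rewrite -[b ^- n.+1]powR_invn ?(ltW b_gt0) // -powRrM [_ * s]mulrC powRrM.
  by rewrite powR_invn ?(ltW bs_gt0) // exprS invfM mulrA divff ?mul1r // gt_eqF.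
by rewrite ler_pM2l // ge0_ler_powR ?nnegrE ?invr_ge0 ?exprn_ge0 // ltW.
Qed.

Section Coding.
Variables (R : realType) (k b : nat) (D : {set {ffun 'I_k -> 'I_b}}).
Hypotheses (b_gt1 : (1 < b)%N) (D_gt1 : (1 < #|D|)%N).
Implicit Types (y : R) (U : set ('I_k -> R)).

Definition coding_digit y (j : nat) : {ffun 'I_k -> 'I_b} :=
  enum_val (Ordinal (greedy_digit_lt D_gt1 y j)).

Definition coding y (i : 'I_k) : R := digit_real R b (fun j => coding_digit y j i).

Definition coding_mass : {outer_measure set ('I_k -> R) -> \bar R} :=
  [the {outer_measure set _ -> \bar R} of
    restricted_pushforward (outer_lebesgue R) `[0, 1]%classic coding].

Local Notation prefix y n i := (digit_prefix b (fun j => coding_digit y j i) n).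

Lemma coding_missing_digit_set y : missing_digit_set D (coding y).
Proof.
apply/(missing_digit_setP _ _ b_gt1).
by exists (coding_digit y) => // j; exact: enum_valP.
Qed.

Lemma coding_prefix_bounds y n i :
  (prefix y n i)%:R <= b%:R ^+ n * coding y i <= (prefix y n i)%:R + 1.
Proof. by apply: digit_prefix_bounds1 => // j; exact: ltn_ord. Qed.

Lemma outer_lebesgue_cylinder_le (n : nat) (v : 'I_k -> nat) :
  (outer_lebesgue R (`[0%R, 1%R] `&` [set y | forall i, prefix y n i = v i])%classic
    <= (#|D|%:R ^- n)%:E)%E.
Proof.
set S := _ `&` _; have M_gt0 : 0 < #|D|%:R ^+ n :> R by rewrite exprn_gt0 // ltr0n ltnW.
have [->|/set0P[y0 [_ /= y0_v]]] := eqVneq S set0.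
  by rewrite outer_measure0 lee_fin invr_ge0 ltW.
pose p := digit_prefix #|D| (greedy_digit #|D| y0) n.
have S_sub : S `<=` `[p%:R / #|D|%:R ^+ n, (p%:R + 1) / #|D|%:R ^+ n].
  move=> y [y01 y_v]; have <- : digit_prefix #|D| (greedy_digit #|D| y) n = p.
    apply: eq_digit_prefix => j lt_jn.
    have /enum_val_inj[] // : coding_digit y j = coding_digit y0 j.
    apply/ffunP => i; apply: val_inj.
    have eq_prefix : prefix y n i = prefix y0 n i by rewrite y_v y0_v.
    by apply: (digit_prefix_inj _ _ eq_prefix) => // ?; exact: ltn_ord.
  rewrite /= in_itv /= in y01.
  rewrite /= in_itv /= ler_pdivrMr // ler_pdivlMr // [y * _]mulrC.
  rewrite -{2 3}(digit_real_greedy D_gt1 y01); apply: digit_prefix_bounds1 => // j.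
  exact: greedy_digit_lt.
apply: le_trans (le_outer_measure (outer_lebesgue R) _ _ S_sub) _.
rewrite outer_lebesgue_itvcc ?ltr_pM2r ?invr_gt0 ?ltrDl //.
by rewrite -mulrBl [_ + 1]addrC addrK mul1r.
Qed.

(* Two points at distance at most [b ^- n] have [n]-digit prefixes differing by at
   most [2] in each coordinate, hence [5] possible differences. *)
Lemma coding_mass_le (U : set ('I_k -> R)) (n : nat) :
  (forall x x', U x -> U x' -> forall i, `|x i - x' i| <= b%:R ^- n) ->
  (coding_mass U <= ((5 ^ k)%:R * #|D|%:R ^- n)%:E)%E.
Proof.
move=> U_small; rewrite /coding_mass /= /restricted_pushforward.
have [->|/set0P[y0 [_ Uy0]]] := eqVneq (`[0, 1] `&` coding @^-1` U) set0.
  by rewrite outer_measure0 lee_fin mulr_ge0 // invr_ge0 exprn_ge0.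
pose S (f : {ffun 'I_k -> 'I_5}) := `[0%R, 1%R]%classic `&`
  [set y | forall i, prefix y n i = (prefix y0 n i + f i - 2)%N].
have cover : `[0, 1] `&` coding @^-1` U `<=` \bigcup_f S f.
  move=> y [y01 Uy].
  have prefix_close i :
      (prefix y0 n i <= prefix y n i + 2)%N /\ (prefix y n i <= prefix y0 n i + 2)%N.
    have /andP[lo0 hi0] := coding_prefix_bounds y0 n i.
    have /andP[lo hi] := coding_prefix_bounds y n i.
    have bX_gt0 : 0 < b%:R ^+ n :> R by rewrite exprn_gt0 // ltr0n ltnW.
    have : `|b%:R ^+ n * coding y i - b%:R ^+ n * coding y0 i| <= 1.
      rewrite -mulrBr normrM gtr0_norm // mulrC -ler_pdivlMr // mul1r.
      exact: U_small.
    by rewrite ler_norml => /andP[]; rewrite -!(ler_nat R) !natrD; split; lra.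
  have lt5 i : (prefix y n i + 2 - prefix y0 n i < 5)%N by have := prefix_close i; lia.
  exists [ffun i => Ordinal (lt5 i)] => //; split=> // i.
  by rewrite ffunE /=; have := prefix_close i; lia.
apply: le_trans (le_outer_measure (outer_lebesgue R) _ _ cover) _.
apply: le_trans (outer_measure_bigcup_fin (outer_lebesgue R) S) _.
apply: le_trans (lee_sum _ (fun f _ => outer_lebesgue_cylinder_le _ _)) _.
by rewrite sumEFin sumr_const card_ffun !card_ord mulr_natl.
Qed.

Lemma coding_mass_missing_digit_set : coding_mass (missing_digit_set D) = 1%E.
Proof.
rewrite /coding_mass /= /restricted_pushforward setIidl.
  by rewrite outer_lebesgue_itvcc ?subr0.
by move=> y _; exact: coding_missing_digit_set.
Qed.

Lemma coding_mass_le_powR (U : set ('I_k -> R)) (r s : R) :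
  0 <= s -> b%:R `^ s <= #|D|%:R -> 0 < r <= 1 -> (diam U <= r%:E)%E ->
  (coding_mass U <= ((5 ^ k)%:R * b%:R `^ s * r `^ s)%:E)%E.
Proof.
move=> s_ge0 le_bD r01 U_le.
have [n /andP[lt_r le_r]] := exists_invX_bracket b_gt1 r01.
apply: le_trans (coding_mass_le (n := n) _) _ => [x x' Ux Ux' i|].
  apply: le_trans le_r; apply: le_trans (ler_dist_edist x x' i) _.
  by rewrite -lee_fin (le_trans _ U_le) // edist_le_diam.
rewrite lee_fin -mulrA ler_wpM2l //.
by apply: invX_le_powR => //; [rewrite ltr0n ltnW | exact: ltW].
Qed.

End Coding.

Lemma hausdorff_dim_missing_digit_ge (R : realType) (k b : nat)
    (D : {set {ffun 'I_k -> 'I_b}}) (s : R) :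
  (1 < b)%N -> b%:R `^ s <= #|D|%:R ->
  (s%:E <= hausdorff_dim (@missing_digit_set R k b D))%E.
Proof.
move=> b_gt1 le_bD; have [s_le0|s_gt0] := leP s 0.
  by apply: le_trans (hausdorff_dim_ge0 _); rewrite lee_fin.
have b_gt0 : 0 < b%:R :> R by rewrite ltr0n ltnW.
have D_gt1 : (1 < #|D|)%N.
  rewrite -(ltr_nat R); apply: lt_le_trans le_bD.
  by rewrite -[ltLHS](congr1 (@^~ s) (powR1 R)) gt0_ltr_powR ?nnegrE ?ltr1n.
have A_gt0 : 0 < (5 ^ k)%:R * b%:R `^ s :> R.
  by rewrite mulr_gt0 ?powR_gt0 // ltr0n expn_gt0.
apply: (mass_distribution_principle (mu := coding_mass R D_gt1) s_gt0 A_gt0).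
  by move=> U r r01 U_le; apply: coding_mass_le_powR => //; exact: ltW.
by rewrite coding_mass_missing_digit_set // lte_fin.
Qed.

(** * Digits restricted in the last coordinate *)

Lemma esum1_le_card (R : realType) (I : finType) (T : choiceType) (B : {set I})
    (f : I -> T) (A : set T) : (forall x, A x -> exists2 i, i \in B & x = f i) ->
  (\esum_(x in A) (1 : \bar R) <= (#|B|%:R)%:E)%E.
Proof.
move=> A_sub; apply: ge_ereal_sup => _ [S [S_fin SA] <-].
rewrite fsbig_finite //= sumEFin lee_fin big_const_seq count_predT iter_addr_0 ler_nat.
rewrite cardE -(size_map f) uniq_leq_size ?finmap.fset_uniq // => x.
rewrite in_fset_set // inE => /SA/A_sub[i Bi ->].
by rewrite map_f // mem_enum.
Qed.

Lemma card_ffun_at (I T : finType) (i0 : I) (S : {set T}) :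
  #|[set f : {ffun I -> T} | f i0 \in S]%SET| = (#|S| * #|T| ^ #|I|.-1)%N.
Proof.
pose F i : pred T := fun x => (i == i0) ==> (x \in S).
have -> : #|[set f : {ffun I -> T} | f i0 \in S]%SET| =
    #|(family F : simpl_pred {ffun I -> T})|.
  apply: eq_card => f; rewrite finset.in_set; apply/idP/familyP => [fS i|/(_ i0)].
    by rewrite unfold_in /F; apply/implyP => /eqP ->.
  by rewrite /F unfold_in eqxx.
rewrite card_family foldrE big_map big_enum (bigD1 i0) //=.
congr (_ * _)%N; first by apply: eq_card => x; rewrite unfold_in /F eqxx.
rewrite -(cardC1 i0) -prod_nat_const; apply: eq_bigr => i /negbTE neq_i.
by apply: eq_card => x; rewrite unfold_in /F neq_i.
Qed.

Lemma card_pair_ffun_at (A I T : finType) (i0 : I) (S : A -> {set T}) :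
  #|[set w : A * {ffun I -> T} | w.2 i0 \in S w.1]%SET| =
  ((\sum_a #|S a|) * #|T| ^ #|I|.-1)%N.
Proof.
rewrite -sum1dep_card -(pair_big_dep xpredT (fun a (f : {ffun I -> T}) => f i0 \in S a)
  (fun _ _ => 1%N)) /= big_distrl.
by apply: eq_bigr => a _; rewrite sum1dep_card card_ffun_at.
Qed.

Definition last_digit_lt (k b N : nat) : {set {ffun 'I_k.+1 -> 'I_b}} :=
  [set f : {ffun 'I_k.+1 -> 'I_b} | f ord_max \in [set d : 'I_b | (d < N)%N]]%SET.

Lemma card_last_digit_lt (k b N : nat) : (N <= b)%N ->
  #|last_digit_lt k b N| = (N * b ^ k)%N.
Proof.
move=> leNb; rewrite card_ffun_at !card_ord; congr (_ * _)%N.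
by rewrite -sum1dep_card -(big_ord_widen _ (fun=> 1%N) leNb) sum1_card card_ord.
Qed.

Lemma last_digit_lt_neq0 (k b N : nat) : (0 < N <= b)%N ->
  last_digit_lt k b N != finset.set0.
Proof.
move=> /andP[N_gt0 leNb]; rewrite -card_gt0 card_last_digit_lt // muln_gt0 N_gt0.
by rewrite expn_gt0 (leq_trans N_gt0).
Qed.

Lemma missing_digit_set_itv (R : realType) (k b : nat) (D : {set {ffun 'I_k -> 'I_b}})
    (x : 'I_k -> R) (i : 'I_k) : (1 < b)%N -> missing_digit_set D x -> 0 <= x i <= 1.
Proof.
move=> b_gt1 /(missing_digit_setP _ _ b_gt1)[d _ ->].
have d_lt j : (d j i < b)%N := ltn_ord _.
by have := digit_prefix_bounds1 R b_gt1 0 d_lt; rewrite mul1r add0r.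
Qed.

Section LastDigit.
Variables (R : realType) (k b N : nat).
Hypotheses (N_gt0 : (0 < N)%N) (lt_Nb : (N < b)%N).

Let b_gt1 : (1 < b)%N. Proof. exact: leq_ltn_trans lt_Nb. Qed.

Local Notation K := (@missing_digit_set R k.+1 b (last_digit_lt k b N)).

Lemma face0_sub_last_digit_lt : @face0 R k.+1 `<=` K.
Proof.
move=> x x_face; apply/(missing_digit_setP _ _ b_gt1).
pose d i := if i == ord_max then fun=> 0%N else greedy_digit b (x i).
have d_lt i j : (d i j < b)%N.
  by rewrite /d; case: eqP => _; [exact: ltnW | exact: greedy_digit_lt].
exists (fun j => [ffun i => Ordinal (d_lt i j)]) => [j|i].
  by rewrite !inE ffunE /= /d eqxx.
under [X in digit_real _ _ X]eq_fun do rewrite ffunE /=.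
have := x_face i; rewrite /d /=; have [->|neq_i] := eqVneq i ord_max.
  rewrite eqxx => ->; apply/eqP; rewrite eq_le digit_real_ge0 //=; last first.
    by move=> _; exact: ltnW.
  by have := digit_real_le R b_gt1 (ltnW b_gt1) (fun=> leqnn 0); rewrite mul0r.
by rewrite [(_ == _)%N](negbTE neq_i) => x01; rewrite digit_real_greedy.
Qed.

Let last_digit_le (f : {ffun 'I_k.+1 -> 'I_b}) :
  f \in last_digit_lt k b N -> (f ord_max <= N.-1)%N.
Proof. by rewrite !inE => lt_fN; rewrite -ltnS prednK. Qed.

Let lt_NB1b : (N.-1 < b)%N. Proof. exact: leq_ltn_trans (leq_pred N) lt_Nb. Qed.

Lemma last_digit_lt_bounds (x : 'I_k.+1 -> R) j : K x -> exists z : nat,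
  z%:R <= b%:R ^+ j * x ord_max <= z%:R + N.-1%:R / (b%:R - 1).
Proof.
move=> /(missing_digit_setP _ _ b_gt1)[d dD ->].
exists (digit_prefix b (fun j => d j ord_max) j).
by apply: digit_prefix_bounds => // i; exact: last_digit_le.
Qed.

Lemma last_coord_lt1 (x : 'I_k.+1 -> R) : K x -> x ord_max < 1.
Proof.
move=> /(missing_digit_setP _ _ b_gt1)[d dD ->].
apply: (le_lt_trans (digit_real_le R b_gt1 lt_NB1b (fun j => last_digit_le (dD j)))).
rewrite ltr_pdivrMr ?subr_gt0 ?ltr1n // mul1r ltrBrDr natr1 prednK //.
by rewrite ltr_nat.
Qed.

Lemma last_coord_narrow (H : nat) (x : 'I_k.+1 -> R) :
  (0 < H)%N -> b = (8 * H * N)%N -> K x -> narrow_orbit b H (x ord_max).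
Proof.
move=> H_gt0 bE Kx j; have [z /andP[lo hi]] := last_digit_lt_bounds j Kx.
exists z; rewrite lo /=; apply: le_trans hi _; rewrite lerD2l.
have H_ge1 : 1 <= H%:R :> R by rewrite ler1n.
rewrite ler_pdivrMr ?subr_gt0 ?ltr1n // ler_pdivlMl ?mulr_gt0 ?ltr0n //.
by rewrite -subn1 natrB // bE !natrM; lra.
Qed.

End LastDigit.

Definition nat_rat_point (k n : nat) (w : 'I_n * {ffun 'I_k -> 'I_n}) :
    {ffun 'I_k -> int} * int :=
  ([ffun i => (w.2 i : nat)%:Z], (w.1 : nat)%:Z).

Lemma rat_points_nat (R : realType) (k : nat) (K : set ('I_k -> R)) (Q : R) p :
  (forall x i, K x -> 0 <= x i <= 1) -> 0 <= Q -> rat_points K Q p ->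
  exists w : 'I_(Num.truncn Q).+1 * {ffun 'I_k -> 'I_(Num.truncn Q).+1},
    [/\ (0 < w.1)%N, p = nat_rat_point w & K (fun i => (w.2 i)%:R / w.1%:R)].
Proof.
case: p => a [q|q] K_itv Q_ge0 [/= q_ge1 [q_le Ka]]; last by [].
have q_gt0 : 0 < q%:R :> R by rewrite ltr0n.
have q_lt : (q < (Num.truncn Q).+1)%N by rewrite ltnS truncn_ge_nat.
have a_itv i : 0 <= a i <= q%:Z.
  have := K_itv _ i Ka; rewrite pmulr_lge0 ?invr_gt0 // ler0z => /andP[-> /=].
  by rewrite ler_pdivrMr // mul1r -[q%:~R]/(q%:Z%:~R) ler_int.
have a_lt i : (`|a i| < (Num.truncn Q).+1)%N by have := a_itv i; lia.
have aE i : a i = `|a i|%N :> int by have := a_itv i; lia.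
exists (Ordinal q_lt, [ffun i => Ordinal (a_lt i)]); split=> //=.
  by congr (_, _); apply/ffunP => i; rewrite !ffunE.
suff -> : (fun i => ([ffun i => Ordinal (a_lt i)] i)%:R / q%:R) =
    (fun i => (a i)%:~R / q%:~R) :> ('I_k -> R) by [].
by apply/funext => i; rewrite ffunE [in RHS]aE.
Qed.

Lemma count_rat_points_le (R : realType) (k b N H : nat) (Q : R) :
  (0 < N)%N -> (0 < H)%N -> b = (8 * H * N)%N -> 0 <= Q ->
  (count_rat_points (@missing_digit_set R k.+1 b (last_digit_lt k b N)) Q <=
   ((\sum_(1 <= q < (Num.truncn Q).+1) #|narrow_numerators R b H q|)
     * (Num.truncn Q).+1 ^ k)%:R%:E)%E.
Proof.
move=> N_gt0 H_gt0 bE Q_ge0; set n := Num.truncn Q.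
have lt_Nb : (N < b)%N by rewrite bE ltn_Pmull //; lia.
have b_gt1 : (1 < b)%N by apply: leq_ltn_trans lt_Nb.
pose S q : {set 'I_n.+1} := [set inord a | a : 'I_q in narrow_numerators R b H q]%SET.
pose B := [set w : 'I_n.+1 * {ffun 'I_k.+1 -> 'I_n.+1} | w.2 ord_max \in S w.1]%SET.
apply: (le_trans (y := (#|B|%:R)%:E)).
  apply: (esum1_le_card R (f := @nat_rat_point _ _)) => p.
  move=> /(rat_points_nat (fun x i => @missing_digit_set_itv _ _ _ _ x i b_gt1) Q_ge0).
  move=> [[q a] /= [q_gt0 -> Ka]]; exists (q, a) => //; rewrite inE /=.
  have a_lt : (a ord_max < q)%N.
    have := last_coord_lt1 N_gt0 lt_Nb Ka.
    by rewrite ltr_pdivrMr ?ltr0n // mul1r ltr_nat.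
  apply/imsetP; exists (Ordinal a_lt); last by rewrite /= inord_val.
  by rewrite inE; apply/asboolP; exact: (last_coord_narrow N_gt0 lt_Nb H_gt0 bE Ka).
rewrite lee_fin ler_nat (card_pair_ffun_at ord_max (fun q : 'I_n.+1 => S q)) !card_ord.
rewrite leq_mul2r; apply/orP; right.
rewrite -(big_mkord xpredT (fun q => #|S q|)) big_ltn //.
have -> : #|S 0%N| = 0%N by apply: eq_card0 => a; apply/imsetP => -[[]].
by apply: leq_sum => q _; exact: leq_imset_card.
Qed.

Lemma exists_nat_powR_ge (R : realType) (c d : R) : 0 < d ->
  exists2 n, (1 < n)%N & c <= n%:R `^ d.
Proof.
move=> d_gt0; exists (Num.truncn (`|c| `^ d^-1)).+2 => //.
apply: (le_trans (y := (`|c| `^ d^-1) `^ d)).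
  by rewrite -powRrM mulVf ?gt_eqF // powRr1 // ler_norm.
rewrite ge0_ler_powR ?nnegrE ?powR_ge0 ?(ltW d_gt0) //.
by apply/ltW/(lt_trans (truncnS_gt _)); rewrite ltr_nat.
Qed.

Lemma count_rat_points_le_powR (R : realType) (k b N H : nat) (d : R) :
  (1 < H)%N -> (0 < N)%N -> b = (8 * H * N)%N -> 0 < d -> 4 <= H%:R `^ d ->
  exists C : R, 0 < C /\ forall Q : R, 1 <= Q ->
    (count_rat_points (@missing_digit_set R k.+1 b (last_digit_lt k b N)) Q
      <= (C * Q `^ (k.+1%:R + 2 * d))%:E)%E.
Proof.
move=> H_gt1 N_gt0 bE d_gt0 le_Hd; have H_gt0 := ltnW H_gt1.
have leHb : (1 < H <= b)%N by rewrite H_gt1 bE -mulnA mulnCA leq_pmulr // muln_gt0.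
have [C C_gt0 sum_le] := sum_card_narrow_numerators_le_powR leHb d_gt0 le_Hd.
exists (C * 2 ^+ k); split=> [|Q Q_ge1]; first by rewrite mulr_gt0 ?exprn_gt0.
have Q_gt0 : 0 < Q by apply: lt_le_trans Q_ge1.
apply: le_trans (count_rat_points_le k N_gt0 H_gt0 bE (ltW Q_gt0)) _.
set n := Num.truncn Q; have n_gt0 : (0 < n)%N by rewrite truncn_gt0.
have n_le : n%:R <= Q by rewrite truncn_le ltW.
rewrite lee_fin natrM natrX.
apply: (le_trans (y := C * n%:R `^ (1 + 2 * d) * (2 * n%:R) ^+ k)).
  rewrite ler_pM ?exprn_ge0 ?sum_le // lerXn2r ?nnegrE ?mulr_ge0 //.
  by rewrite -natrM ler_nat; lia.
have -> : k.+1%:R + 2 * d = (1 + 2 * d) + k%:R by rewrite -natr1; ring.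
rewrite [Q `^ _]powRD; last by rewrite (gt_eqF Q_gt0) implybT.
rewrite powR_mulrn ?(ltW Q_gt0) // exprMn mulrACA ler_wpM2l //.
  by rewrite mulr_ge0 ?exprn_ge0 // ltW.
rewrite ler_pM ?powR_ge0 ?exprn_ge0 ?lerXn2r ?nnegrE ?(ltW Q_gt0) //.
by rewrite ge0_ler_powR ?nnegrE ?addr_ge0 ?mulr_ge0 // ltW.
Qed.

Lemma hausdorff_dim_last_digit_ge (R : realType) (k b N : nat) (d : R) :
  (0 < N < b)%N -> b%:R <= N%:R * b%:R `^ d ->
  ((k.+1%:R - d)%:E <=
    hausdorff_dim (@missing_digit_set R k.+1 b (last_digit_lt k b N)))%E.
Proof.
move=> /andP[N_gt0 lt_Nb] le_b; have b_gt1 : (1 < b)%N by apply: leq_ltn_trans lt_Nb.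
have b_gt0 : 0 < b%:R :> R by rewrite ltr0n ltnW.
apply: hausdorff_dim_missing_digit_ge => //.
rewrite card_last_digit_lt ?(ltnW lt_Nb) // powRB; last by rewrite (gt_eqF b_gt0) implybT.
rewrite powR_mulrn ?(ltW b_gt0) // ler_pdivrMr ?powR_gt0 //.
by rewrite natrM natrX exprS mulrAC ler_pM2r ?exprn_gt0.
Qed.

Theorem theorem1p15 (R : realType) (k : nat) (eta : R) :
  (1 <= k)%N -> 0 < eta ->
  exists K : set ('I_k -> R),
    is_missing_digit_fractal K /\
    @face0 R k `<=` K /\
    (exists C : R, 0 < C /\
       forall Q : R, 1 <= Q ->
         (count_rat_points K Q <= (C * Q `^ (k%:R + eta))%:E)%E) /\
    (hausdorff_dim K > (k%:R - eta)%:E)%E.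
Proof.
case: k => // k _ eta_gt0; have d_gt0 : 0 < eta / 2 by rewrite divr_gt0.
have [H H_gt1 le_H] := exists_nat_powR_ge 4 d_gt0.
have [N N_gt1 le_N] := exists_nat_powR_ge (8 * H%:R) d_gt0.
have N_gt0 := ltnW N_gt1; pose b := (8 * H * N)%N.
have lt_Nb : (N < b)%N by rewrite /b ltn_Pmull //; lia.
exists (@missing_digit_set R k.+1 b (last_digit_lt k b N)); split; [|split; [|split]].
- exists b, (last_digit_lt k b N); split; first exact: leq_ltn_trans lt_Nb.
  by split=> //; rewrite last_digit_lt_neq0 // N_gt0 ltnW.
- exact: face0_sub_last_digit_lt.
- have -> : eta = 2 * (eta / 2) by rewrite mulrC divfK.
  exact: (count_rat_points_le_powR k H_gt1 N_gt0 erefl d_gt0 le_H).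
- apply: (lt_le_trans (y := (k.+1%:R - eta / 2)%:E)); first by rewrite lte_fin; lra.
  apply: hausdorff_dim_last_digit_ge; first by rewrite N_gt0.
  rewrite [X in X <= _]natrM mulrC ler_wpM2l // natrM; apply: le_trans le_N _.
  by rewrite ge0_ler_powR ?nnegrE ?(ltW d_gt0) // ler_nat ltnW.
Qed.
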